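(* Let $Y\in\mathcal{G}$, let $x\ge0$, and let $W_n^Y(x)$ be the probabilistic Fubini polynomials associated with $Y$. Then for all $n\ge1$, $$W_n^Y(x)=x\sum_{k=1}^n\binom{n}{k}\,\mathbb{E}[Y^k]\,W_{n-k}^Y(x).$$
   Context: $\mathbb{N}_0=\{0,1,2,\dots\}$. $\mathcal{G}$ is the set of real random variables $Y$ such that $\mathbb{E}|Y|^n<\infty$ for all $n\in\mathbb{N}_0$ and, for some $r>0$, $\lim_{n\to\infty}|t|^n\mathbb{E}|Y|^n/n!=0$ for all $|t|<r$. Let $Y_1,Y_2,\dots$ be i.i.d. copies of $Y$, $S_0=0$ and $S_i=Y_1+\cdots+Y_i$ for $i\ge1$. The convention $0^0=1$ is used. For $x\ge0$ the probabilistic Fubini polynomials associated with $Y$ are $$W_n^Y(x)=\sum_{i=0}^{\infty}\mathbb{E}[S_i^n]\,P\{G_{\eta(x)}=i+1\}=\sum_{i=0}^\infty \mathbb{E}[S_i^n]\,\frac{1}{1+x}\left(\frac{x}{1+x}\right)^i,\qquad n\in\mathbb{N}_0,$$ where $\eta(x)=1/(1+x)$ and $G_p$ is geometric with $P\{G_p=i\}=p(1-p)^{i-1}$, $i\ge1$. *)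

(* Defs.v *)
From mathcomp Require Import all_boot all_order all_algebra.
From mathcomp Require Import all_classical all_reals all_analysis.

Set Implicit Arguments.
Unset Strict Implicit.
Unset Printing Implicit Defensive.

Import Order.TTheory GRing.Theory Num.Theory.
Import numFieldNormedType.Exports.

Local Open Scope classical_set_scope.
Local Open Scope ring_scope.

Definition class_G (R : realType) (d : measure_display) (T : measurableType d)
    (P : probability T R) (Y : {RV P >-> R}) : Prop :=
  (forall n : nat, ('E_P[fun w => (`|Y w| ^+ n)%R] < +oo)%E) /\
  (exists2 r : R, 0 < r & forall t : R, `|t| < r ->
    (fun n : nat => ((`|t| ^+ n)%R%:E * 'E_P[fun w => (`|Y w| ^+ n)%R]
                     * (n`!%:R^-1)%R%:E)%E) @ \oo --> (0 : \bar R)%E).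

Definition mutually_independent (R : realType) (d : measure_display)
    (T : measurableType d) (P : probability T R)
    (X : nat -> {RV P >-> R}) : Prop :=
  forall (J : seq nat) (A : nat -> set R), uniq J ->
    (forall j, measurable (A j)) ->
    P [set w | forall j, j \in J -> A j (X j w)] =
    (\prod_(j <- J) P (X j @^-1` A j))%E.

(* Y may live on a probability space of its own: only its law matters. *)
Definition iid_copies (R : realType)
    (d' : measure_display) (T' : measurableType d') (Q : probability T' R)
    (Y : {RV Q >-> R})
    (d : measure_display) (T : measurableType d) (P : probability T R)
    (X : nat -> {RV P >-> R}) : Prop :=
  (forall (j : nat) (A : set R), measurable A ->
     distribution P (X j) A = distribution Q Y A) /\
  mutually_independent X.

(* Indices are shifted by one: X 0, X 1, ... stand for Y_1, Y_2, ... *)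
Definition partial_sum (R : realType) (d : measure_display)
    (T : measurableType d) (P : probability T R)
    (X : nat -> {RV P >-> R}) (i : nat) : T -> R :=
  fun w => \sum_(j < i) X j w.

Definition geometric_pmf (R : realType) (p : R) (i : nat) : R :=
  if (0 < i)%N then p * (1 - p) ^+ i.-1 else 0.

Definition eta (R : realType) (x : R) : R := (1 + x)^-1.

(* W_n^Y(x), where X is a sequence of i.i.d. copies of Y.  It is stated in
   \bar R, where the library's expectations live; geometric_pmf_eta gives the
   explicit weights. *)
Definition fubini (R : realType) (d : measure_display) (T : measurableType d)
    (P : probability T R) (X : nat -> {RV P >-> R}) (n : nat) (x : R)
    : \bar R :=
  (\sum_(0 <= i <oo) ('E_P[fun w => (partial_sum X i w ^+ n)%R]
                      * (geometric_pmf (eta x) i.+1)%:E))%E.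

Lemma geometric_pmf_eta (R : realType) (x : R) (i : nat) : 0 <= x ->
  geometric_pmf (eta x) i.+1 = (1 + x)^-1 * (x / (1 + x)) ^+ i.
Proof.
move=> x0; rewrite /geometric_pmf /eta /=; congr (_ * _ ^+ _).
have x1 : 1 + x != 0 by rewrite gt_eqF // ltr_pwDl.
by rewrite -[X in X - _](divff x1) -[X in _ - X]mul1r -mulrBl addrC addKr.
Qed.

(* Main.v *)
From HB Require Import structures.
Require Import Defs.
From mathcomp Require Import all_boot all_order all_algebra.
From mathcomp Require Import all_classical all_reals all_analysis.
From mathcomp Require Import measurable_realfun ring lra.

(** The recurrence comes from conditioning on the first step of the random
walk.  Write s_i(n) = E[S_i^n] and m_k = E[Y^k].  Expanding
S_(i+1)^n = (S_i + Y_(i+1))^n by the binomial formula and using that S_i and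
Y_(i+1) are independent gives
  s_(i+1)(n) = sum_(0 <= k <= n) C(n,k) m_k s_i(n-k)   ([partial_sum_moments]).
Multiply by q^i, where q = x/(1+x), and sum over i < N: the partial sums
A_N(n) = sum_(i < N) s_i(n) q^i satisfy
  A_(N+1)(n) = q A_N(n) + (s_0(n) + q sum_(1 <= k <= n) C(n,k) m_k A_N(n-k)),
where the k = 0 term has been isolated.  The bracket involves only orders
below n, so by strong induction on n it converges as N grows; since |q| < 1
the affine recursion then forces A_N(n) to converge, to the fixed point
w(n) = (s_0(n) + q sum_(1 <= k <= n) C(n,k) m_k w(n-k)) / (1 - q)
([cvg_affine_recursion], [binomial_recursion_cvg]).  So summability of the
series defining the Fubini polynomials and their recurrence are obtained
together, without any growth estimate on the moments of S_i.  Finally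
s_0(n) = 0 for n >= 1, and q / (1 - q) = x.

On the probabilistic side, two facts have to be drawn from mutual independence
stated on events: S_i is independent of Y_(i+1)
([partial_sum_block_independent], an induction on i), and the expectation of a
product of independent integrable variables factors
([independent_expectationM], Fubini for the joint law, which is a product
measure).  *)

Set Implicit Arguments.
Unset Strict Implicit.
Unset Printing Implicit Defensive.

Import Order.TTheory GRing.Theory Num.Theory.
Import numFieldNormedType.Exports.

Local Open Scope classical_set_scope.
Local Open Scope ring_scope.

(** * Power series whose coefficients satisfy a binomial recursion *)

(** The error a_N - L to the fixed point L is contracted by q up to a
perturbation b_N - l that tends to 0. *)
Lemma cvg_affine_recursion (R : realType) (q : R) (a b : nat -> R) (l : R) :
  `|q| < 1 -> (forall N, a N.+1 = q * a N + b N) ->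
  b @ \oo --> l -> a @ \oo --> l / (1 - q).
Proof.
move=> q1 arec bl.
have q1' : 1 - q != 0.
  by rewrite subr_eq0; apply: contraTneq q1 => <-; rewrite normr1 ltxx.
set L := l / (1 - q).
have Lfix : L = q * L + l by rewrite /L; field.
have err N : a N.+1 - L = q * (a N - L) + (b N - l).
  by rewrite arec {1}Lfix; ring.
apply/cvgrPdist_lt => e e0.
have e2 : 0 < e / 2 by rewrite divr_gt0.
have : 0 < e / 2 * (1 - `|q|) by rewrite mulr_gt0// subr_gt0.
move/cvgrPdist_le : bl => /[apply] -[M _ bM].
(* The slack e / 2 reproduces itself:
   |q| (e / 2) + (e / 2) (1 - |q|) = e / 2. *)
have bound k : `|a (M + k)%N - L| <= `|q| ^+ k * `|a M - L| + e / 2.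
  elim: k => [|k IH]; first by rewrite addn0 expr0 mul1r lerDl ltW.
  rewrite addnS err (le_trans (ler_normD _ _))// normrM.
  have := bM (M + k)%N (leq_addr _ _); rewrite distrC => bk.
  have := ler_wpM2l (normr_ge0 q) IH; rewrite exprS; move: bk; lra.
have : (fun k => `|a M - L| * `|q| ^+ k) @ \oo --> (0 : R).
  by apply: cvg_geometric; rewrite normr_id.
move/cvgrPdist_lt => /(_ _ e2)[K _ qK].
exists (M + K)%N => // N /= MKN.
rewrite distrC -(subnKC (leq_trans (leq_addr _ _) MKN)).
apply: (le_lt_trans (bound _)).
have := qK (N - M)%N _; rewrite /= leq_subRL ?(leq_trans (leq_addr _ _) MKN)//.
move=> /(_ MKN); rewrite sub0r normrN ger0_norm ?mulr_ge0 ?exprn_ge0// mulrC.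
lra.
Qed.

Lemma sum_geometric_recl (R : realType) (q : R) (s : nat -> R) N :
  \sum_(i < N.+1) s i * q ^+ i = s 0%N + q * \sum_(i < N) s i.+1 * q ^+ i.
Proof.
rewrite big_ord_recl expr0 mulr1; congr (_ + _).
by rewrite mulr_sumr; apply: eq_bigr => i _; rewrite exprS mulrCA.
Qed.

(** Convergence and the value of the sum come out of the same induction on n:
the k = 0 term turns the recursion on s into an affine recursion for the
partial sums, driven by the partial sums of lower order. *)
Lemma binomial_recursion_cvg (R : realType) (s : nat -> nat -> R) (m : nat -> R)
    (q : R) :
  `|q| < 1 -> m 0%N = 1 ->
  (forall i n, s i.+1 n =
     \sum_(0 <= k < n.+1) 'C(n, k)%:R * m k * s i (n - k)%N) ->
  exists w : nat -> R,
    (forall n, (fun N => \sum_(i < N) s i n * q ^+ i) @ \oo --> w n) /\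
    (forall n, w n = (s 0%N n + q *
       \sum_(1 <= k < n.+1) 'C(n, k)%:R * m k * w (n - k)%N) / (1 - q)).
Proof.
move=> q1 m0 srec.
pose a n N := \sum_(i < N) s i n * q ^+ i.
have arec n N : a n N.+1 = q * a n N + (s 0%N n +
    q * \sum_(1 <= k < n.+1) 'C(n, k)%:R * m k * a (n - k)%N N).
  rewrite /a (sum_geometric_recl q (s^~ n)) addrCA; congr (_ + _).
  rewrite -mulrDr; congr (_ * _).
  under eq_bigr do rewrite srec big_ltn// bin0 m0 !mul1r subn0 mulrDl.
  rewrite big_split/=; congr (_ + _).
  under eq_bigr do rewrite mulr_suml.
  rewrite exchange_big/=; apply: eq_bigr => k _.
  by rewrite mulr_sumr; apply: eq_bigr => i _; rewrite mulrA.
have limstep n (w : nat -> R) :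
    (forall k, (0 < k <= n)%N -> a (n - k)%N @ \oo --> w (n - k)%N) ->
    a n @ \oo --> (s 0%N n + q *
      \sum_(1 <= k < n.+1) 'C(n, k)%:R * m k * w (n - k)%N) / (1 - q).
  move=> acvg; apply: (cvg_affine_recursion q1 (arec n)).
  apply: cvgD; first exact: cvg_cst.
  apply: cvgMl_tmp.
  rewrite big_nat; under eq_fun do rewrite big_nat.
  apply: cvg_big => [|k kn]; first exact: add_continuous.
  by apply: cvgMl_tmp; exact: acvg.
have acvg n : cvgn (a n).
  elim/ltn_ind: n => n IH; apply: (cvgP _ (limstep n (fun k => limn (a k)) _)).
  by move=> k /andP[k0 kn]; apply: IH; rewrite ltn_subrL k0 (leq_trans k0).
exists (fun n => limn (a n)); split=> n; first exact: acvg.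
apply: cvg_lim => //.
by apply: (limstep n (fun k => limn (a k))) => k _; exact: acvg.
Qed.

(** * Independence: pairs and products *)

(** Independence of C from the pair (U, V) reduces to rectangles because
the law of (U, V) restricted to C and the law of (U, V) scaled by P C are finite
measures that agree on the pi-system of rectangles. *)
Lemma independent_event_pair (R : realType) (d d1 d2 : measure_display)
    (T : measurableType d) (T1 : measurableType d1) (T2 : measurableType d2)
    (P : probability T R) (U : T -> T1) (V : T -> T2) (C : set T) :
  measurable_fun setT U -> measurable_fun setT V -> measurable C ->
  (forall A B, measurable A -> measurable B ->
    P (U @^-1` A `&` V @^-1` B `&` C) =
    (P (U @^-1` A `&` V @^-1` B) * P C)%E) ->
  forall D : set (T1 * T2), measurable D ->
    P ((fun w => (U w, V w)) @^-1` D `&` C) =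
    (P ((fun w => (U w, V w)) @^-1` D) * P C)%E.
Proof.
move=> mU mV mC rect D mD.
have mUV := measurable_fun_pair mU mV.
set Z := fun w => (U w, V w).
have PC0 : 0 <= fine (P C) by rewrite fine_ge0.
pose law (mu : {measure set T -> \bar R}) :
    {measure set (T1 * T2) -> \bar R} :=
  pushforward mu Z.
pose given := law mUV (mrestr P mC).
pose scaled : {measure set (T1 * T2) -> \bar R} :=
  mscale (NngNum PC0) (law mUV P).
have scaledE A : scaled A = (P (Z @^-1` A) * P C)%E.
  rewrite /scaled/= /mscale/= /pushforward muleC fineK//.
  exact: fin_num_measure.
rewrite -scaledE.
pose rects : set (set (T1 * T2)) :=
  [set A `*` B | A in (measurable : set (set T1))
               & B in (measurable : set (set T2))].
have rectT : rects setT by exists setT => //; exists setT => //; rewrite setXTT.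
apply: (@measure_unique _ _ _ rects (fun=> setT) _ _ _ _ given scaled) => //.
- exact: measurable_prod_measurableType.
- move=> _ _ [A mA [B mB <-]] [A' mA' [B' mB' <-]]; rewrite -setXI.
  exists (A `&` A'); first exact: measurableI.
  by exists (B `&` B') => //; exact: measurableI.
- by rewrite bigcup_const.
- by move=> _ [A mA [B mB <-]]; rewrite scaledE; exact: rect.
- move=> _; rewrite /given/= /pushforward /mrestr preimage_setT setTI.
  by rewrite (le_lt_trans (probability_le1 _ _)) ?ltry.
Qed.

(** Independence makes the joint law of (U, V) the product of the two laws, so
that Tonelli gives E|UV| = E|U| E|V|, hence integrability, and then Fubini
gives the factorization. *)
Lemma independent_expectationM (R : realType) (d : measure_display)
    (T : measurableType d) (P : probability T R) (U V : T -> R) :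
  measurable_fun setT U -> measurable_fun setT V ->
  (forall A B : set R, measurable A -> measurable B ->
    P (U @^-1` A `&` V @^-1` B) = (P (U @^-1` A) * P (V @^-1` B))%E) ->
  P.-integrable setT (EFin \o U) -> P.-integrable setT (EFin \o V) ->
  P.-integrable setT (EFin \o (fun w => U w * V w)) /\
  ('E_P[fun w => (U w * V w)%R] = 'E_P[U] * 'E_P[V])%E.
Proof.
move=> mU mV indep iU iV.
pose U' : {RV P >-> R} := HB.pack U (isMeasurableFun.Build _ _ _ _ _ mU).
pose V' : {RV P >-> R} := HB.pack V (isMeasurableFun.Build _ _ _ _ _ mV).
pose muU : probability R R := distribution P U'.
pose muV : probability R R := distribution P V'.
have mUV : measurable_fun setT (fun w => (U w, V w)).
  exact: measurable_fun_pair.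
have joint D : measurable D ->
    (muU \x muV)%E D = pushforward P (fun w => (U w, V w)) D.
  pose law : {measure set (R * R) -> \bar R} :=
    pushforward P (fun w => (U w, V w)).
  exact: (@product_measure_unique _ _ _ _ _ muU muV (law mUV)).
pose f (z : R * R) := (z.1 * z.2)%:E.
have mf : measurable_fun [set: R * R] f.
  by apply/measurable_EFinP; apply: measurable_funM.
have mid : measurable_fun [set: R] (@EFin R) by exact/measurable_EFinP.
have imuU : muU.-integrable setT (@EFin R) by exact: integrable_pushforward.
have imuV : muV.-integrable setT (@EFin R) by exact: integrable_pushforward.
have intf : (muU \x muV)%E.-integrable setT f.
  apply/integrable12ltyP => //.
  rewrite (_ : (fun u => _) =
    (fun u => `|u%:E| * \int[muV]_v `|v%:E|)%E); last first.
    apply/funext => u; rewrite -ge0_integralZl//; last exact: measurableT_comp.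
    by apply: eq_integral => v _; rewrite /f/= normrM.
  rewrite ge0_integralZr//; [|exact: measurableT_comp|exact: integral_ge0].
  by apply: lte_mul_pinfty; rewrite ?integral_ge0//;
    have /integrableP[_] := imuU; have /integrableP[_] := imuV;
    rewrite // ge0_fin_numE ?integral_ge0.
have iUV : P.-integrable setT (f \o (fun w => (U w, V w))).
  have /integrableP[_] := intf.
  rewrite (eq_measure_integral _ (fun D mD _ => joint D mD)).
  rewrite ge0_integral_pushforward//; last exact: measurableT_comp.
  by move=> ?; apply/integrableP; split => //; exact: measurableT_comp.
split; first exact: iUV.
rewrite unlock.
rewrite [LHS](_ : _ = \int[P]_w (f \o (fun w => (U w, V w))) w)%E//.
rewrite -[LHS](integral_pushforward mUV mf (D := setT))//.
rewrite -(eq_measure_integral _ (fun D mD _ => joint D mD)).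
rewrite -integral12_prod_meas1//.
transitivity (\int[muU]_u (u%:E * \int[muV]_v v%:E))%E.
  by apply: eq_integral => u _; rewrite -integralZl.
have <- := fineK (integrable_fin_num measurableT imuV).
rewrite integralZr// fineK ?integrable_fin_num//.
rewrite (integral_pushforward _ _ (D := setT) iU)//.
rewrite (integral_pushforward _ _ (D := setT) iV)//.
exact: mUV.
Qed.

(** * Partial sums of an independent sequence *)

(** The event that X_i, ..., X_(i+m-1) fall in prescribed sets. The indices are
a list so that mutual independence applies to it as it stands. *)
Definition block (R : realType) (d : measure_display) (T : measurableType d)
    (P : probability T R) (X : nat -> {RV P >-> R}) (i m : nat)
    (A : nat -> set R) : set T :=
  [set w | forall j, j \in iota i m -> A j (X j w)].

Section sums.
Context (R : realType) (d : measure_display) (T : measurableType d)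
  (P : probability T R) (X : nat -> {RV P >-> R}).

Lemma block0 i A : block X i 0 A = setT.
Proof. by apply/seteqP; split => // w _ j. Qed.

Lemma blockS i m A : block X i m.+1 A = X i @^-1` A i `&` block X i.+1 m A.
Proof.
apply/seteqP; split => [w Aw|w [Ai Aw] j].
  by split=> [|j jm]; apply: Aw; rewrite /= inE ?eqxx ?jm ?orbT.
by rewrite /= inE => /predU1P[->//|]; exact: Aw.
Qed.

Lemma block_update i m A B :
  block X i m.+1 (fun j => if j == i then B else A j) =
  X i @^-1` B `&` block X i.+1 m A.
Proof.
rewrite blockS eqxx; congr (_ `&` _); apply/seteqP; split => w Aw j jm;
  move: (Aw j jm); case: eqP => // ji; by move: jm; rewrite ji mem_iota ltnn.
Qed.

Lemma measurable_block i m A :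
  (forall j, measurable (A j)) -> measurable (block X i m A).
Proof.
move=> mA; elim: m i => [|m IH] i; first by rewrite block0.
rewrite blockS; apply: measurableI => //.
by rewrite -[_ @^-1` _]setTI; exact: measurable_funPT.
Qed.

Lemma measurable_partial_sum i : measurable_fun setT (partial_sum X i).
Proof. exact: measurable_sum. Qed.

Lemma partial_sumS i w : partial_sum X i.+1 w = partial_sum X i w + X i w.
Proof. exact: big_ord_recr. Qed.

Lemma probability_block_update i m A (B : set R) :
  mutually_independent X ->
  (forall j, measurable (A j)) -> measurable B ->
  P (X i @^-1` B `&` block X i.+1 m A) =
  (P (X i @^-1` B) * P (block X i.+1 m A))%E.
Proof.
move=> indepX mA mB; rewrite -block_update.
rewrite [LHS]indepX ?iota_uniq//; last by move=> j; case: ifP.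
rewrite [P (block _ _ _ _)]indepX ?iota_uniq// big_cons eqxx; congr (_ * _)%E.
by apply: eq_big_seq => j; rewrite mem_iota; case: eqP => // ->; rewrite ltnn.
Qed.

(** The whole block of later variables is carried along because the inductive
step consumes its first variable: given the events X_j in A_j for j > i, the
pair (S_i, X_i) keeps its law on rectangles by the induction hypothesis for
the block starting at i, hence on the set of pairs with sum in B. *)
Lemma partial_sum_block_independent i m A (B : set R) :
  mutually_independent X ->
  (forall j, measurable (A j)) -> measurable B ->
  P (partial_sum X i @^-1` B `&` block X i m A) =
  (P (partial_sum X i @^-1` B) * P (block X i m A))%E.
Proof.
move=> indepX; elim: i m A B => [|i IH] m A B mA mB.
  (* S_0 is constant, so its events are trivial. *)
  rewrite [partial_sum X 0](_ : _ = cst 0); last first.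
    by apply/funext => w; rewrite /partial_sum big_ord0.
  rewrite preimage_cst; case: ifP => _.
    by rewrite setTI probability_setT mul1e.
  by rewrite set0I measure0 mul0e.
have rect (D E : set R) m' A' : measurable D -> measurable E ->
    (forall j, measurable (A' j)) ->
    P (partial_sum X i @^-1` D `&` (X i @^-1` E `&` block X i.+1 m' A')) =
    (P (partial_sum X i @^-1` D) *
     (P (X i @^-1` E) * P (block X i.+1 m' A')))%E.
  move=> mD mE mA'; rewrite -probability_block_update// -block_update.
  by apply: IH => // j; case: ifP.
have := @independent_event_pair R _ _ _ T _ _ P (partial_sum X i) (X i)
  (block X i.+1 m A) (measurable_partial_sum i) (measurable_funPT (X i))
  (measurable_block i.+1 m mA) _ ((fun z => z.1 + z.2) @^-1` B) _.
rewrite (_ : _ @^-1` _ = partial_sum X i.+1 @^-1` B); last first.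
  by apply/funext => w; rewrite /preimage/= partial_sumS.
apply.
- move=> D E mD mE; rewrite -setIA rect//.
  have := rect D E 0%N A mD mE mA.
  rewrite !block0 setIT probability_setT mule1 => ->.
  by rewrite muleA.
- by rewrite -[_ @^-1` _]setTI; apply: measurable_funD.
Qed.

Lemma partial_sum_independent i (A B : set R) :
  mutually_independent X -> measurable A -> measurable B ->
  P (partial_sum X i @^-1` A `&` X i @^-1` B) =
  (P (partial_sum X i @^-1` A) * P (X i @^-1` B))%E.
Proof.
move=> indepX mA mB.
have := @partial_sum_block_independent i 1 (fun=> B) A indepX (fun=> mB) mA.
by rewrite blockS block0 setIT.
Qed.

(** The mixed moments in the binomial expansion of (S_i + X_i)^n factor by
independence, which also makes them finite; finiteness is part of the conclusion
so that it propagates from S_i to S_(i+1). *)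
Lemma partial_sum_moments i :
  mutually_independent X ->
  (forall k, P.-integrable setT (EFin \o (fun w => X i w ^+ k))) ->
  (forall k, P.-integrable setT (EFin \o (fun w => partial_sum X i w ^+ k))) ->
  forall n,
  P.-integrable setT (EFin \o (fun w => partial_sum X i.+1 w ^+ n)) /\
  ('E_P[fun w => (partial_sum X i.+1 w ^+ n)%R] =
   \sum_(0 <= k < n.+1) ('C(n, k)%:R)%R%:E * 'E_P[fun w => (X i w ^+ k)%R]
     * 'E_P[fun w => (partial_sum X i w ^+ (n - k))%R])%E.
Proof.
move=> indepX iX iS n.
have mpow (U : T -> R) k : measurable_fun setT U ->
    measurable_fun setT (fun w => U w ^+ k).
  by move=> mU; apply: measurable_funX.
have factor k l :
    P.-integrable setT
      (EFin \o (fun w => partial_sum X i w ^+ k * X i w ^+ l)) /\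
    ('E_P[fun w => (partial_sum X i w ^+ k * X i w ^+ l)%R] =
     'E_P[fun w => (partial_sum X i w ^+ k)%R] *
     'E_P[fun w => (X i w ^+ l)%R])%E.
  apply: independent_expectationM => //.
  - by apply: mpow; exact: measurable_partial_sum.
  - by apply: mpow.
  - move=> A B mA mB.
    apply: (@partial_sum_independent i ((fun x => x ^+ k) @^-1` A)
      ((fun x => x ^+ l) @^-1` B)) => //;
      rewrite -[_ @^-1` _]setTI; exact: exprn_measurable.
have expand : (EFin \o (fun w => partial_sum X i.+1 w ^+ n)) =
    (fun w => \sum_(0 <= k < n.+1) ('C(n, k)%:R)%R%:E *
      (EFin \o (fun w => partial_sum X i w ^+ (n - k) * X i w ^+ k)%R) w)%E.
  apply/funext => w /=; rewrite partial_sumS exprDn -sumEFin big_mkord.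
  by apply: eq_bigr => k _; rewrite -EFinM mulr_natl.
have term k : P.-integrable setT (fun w => (('C(n, k)%:R)%R%:E *
      (EFin \o (fun w => partial_sum X i w ^+ (n - k) * X i w ^+ k)%R) w)%E).
  by apply: integrableZl => //; have [] := factor (n - k)%N k.
split; first by rewrite expand; apply: integrable_sum.
rewrite [in LHS]unlock.
rewrite [LHS](_ : _ =
  \int[P]_w (EFin \o (fun w => partial_sum X i.+1 w ^+ n)%R) w)%E//.
rewrite expand integral_sum//.
apply: eq_bigr => k _; have [ik Ek] := factor (n - k)%N k.
rewrite integralZl// -muleA; congr (_ * _)%E.
by rewrite muleC -Ek unlock.
Qed.

End sums.

Lemma identically_distributed_expectation (R : realType)
    (d' : measure_display) (T' : measurableType d') (Q : probability T' R)
    (Y : {RV Q >-> R}) (d : measure_display) (T : measurableType d)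
    (P : probability T R) (X : {RV P >-> R}) (f : R -> R) :
  (forall A : set R, measurable A -> distribution P X A = distribution Q Y A) ->
  measurable_fun setT f -> Q.-integrable setT (EFin \o (f \o Y)) ->
  P.-integrable setT (EFin \o (f \o X)) /\ 'E_P[f \o X]%E = 'E_Q[f \o Y]%E.
Proof.
move=> XY mf iY.
have mEf : measurable_fun setT (EFin \o f) by exact/measurable_EFinP.
have iX : P.-integrable setT (EFin \o (f \o X)).
  apply/integrableP; split.
    by apply: measurableT_comp => //; exact: measurableT_comp.
  have mabs : measurable_fun setT (abse \o (EFin \o f)).
    exact: measurableT_comp.
  have abs0 y : (0 <= (abse \o (EFin \o f)) y)%E by exact: abse_ge0.
  have -> : (\int[P]_w `|(EFin \o (f \o X)) w| =
              \int[Q]_w `|(EFin \o (f \o Y)) w|)%E.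
    rewrite -(ge0_integral_distribution X mabs abs0).
    rewrite -(ge0_integral_distribution Y mabs abs0).
    by apply: eq_measure_integral => A mA _; exact: XY.
  by have /integrableP[] := iY.
split => //; rewrite !unlock.
rewrite -[LHS](@integral_distribution _ _ _ _ _ P X (EFin \o f))//.
rewrite -[RHS](@integral_distribution _ _ _ _ _ Q Y (EFin \o f))//.
by apply: eq_measure_integral => A mA _; exact: XY.
Qed.

Lemma class_G_integrable (R : realType) (d : measure_display)
    (T : measurableType d) (P : probability T R) (Y : {RV P >-> R}) (k : nat) :
  class_G Y -> P.-integrable setT (EFin \o (fun w => Y w ^+ k)).
Proof.
move=> [/(_ k) Yk _]; apply/integrableP; split.
  by apply/measurable_EFinP; exact: measurable_funX.
move: Yk; rewrite unlock; congr (_ < _)%E.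
by apply: eq_integral => w _; rewrite /= normrX.
Qed.

Lemma partial_sum_integrable (R : realType) (d : measure_display)
    (T : measurableType d) (P : probability T R) (X : nat -> {RV P >-> R}) :
  mutually_independent X ->
  (forall j k, P.-integrable setT (EFin \o (fun w => X j w ^+ k))) ->
  forall i n, P.-integrable setT (EFin \o (fun w => partial_sum X i w ^+ n)).
Proof.
move=> indepX iX; elim=> [|i IH] n.
  rewrite [X in _.-integrable _ X](_ : _ = cst (0 ^+ n)%:E); last first.
    by apply/funext => w; rewrite /= /partial_sum big_ord0.
  exact: finite_measure_integrable_cst.
by have [] := partial_sum_moments indepX (iX i) IH n.
Qed.

(** * Fubini polynomials *)

Lemma fubini_EFin (R : realType) (d : measure_display)
    (T : measurableType d) (P : probability T R) (X : nat -> {RV P >-> R})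
    (x : R) (n : nat) (s : nat -> R) (l : R) :
  0 <= x ->
  (forall i, ('E_P[fun w => (partial_sum X i w ^+ n)%R] = (s i)%:E)%E) ->
  (fun N => \sum_(i < N) s i * (x / (1 + x)) ^+ i) @ \oo --> l ->
  fubini X n x = ((1 + x)^-1 * l)%:E.
Proof.
move=> x0 sE sl; apply: cvg_lim => //.
rewrite (_ : (fun N => _) = EFin \o
    (fun N => (1 + x)^-1 * \sum_(i < N) s i * (x / (1 + x)) ^+ i)).
  by apply: cvg_EFin; [exact: nearW|exact: cvgMl_tmp].
apply/funext => N /=; rewrite mulr_sumr big_mkord -sumEFin.
apply: eq_bigr => i _.
by rewrite sE geometric_pmf_eta// -EFinM mulrCA.
Qed.

Theorem proposition2p3 (R : realType)
    (d' : measure_display) (T' : measurableType d') (Q : probability T' R)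
    (Y : {RV Q >-> R})
    (d : measure_display) (T : measurableType d) (P : probability T R)
    (X : nat -> {RV P >-> R})
    (Y_in_G : class_G Y) (X_copies : iid_copies Y X)
    (x : R) (x_ge0 : 0 <= x) (n : nat) (n_ge1 : (1 <= n)%N) :
  (fubini X n x =
   x%:E * \sum_(1 <= k < n.+1)
            ('C(n, k)%:R)%R%:E * 'E_Q[fun w => (Y w ^+ k)%R] * fubini X (n - k)%N x)%E.
Proof.
have [distX indepX] := X_copies.
have iY k := class_G_integrable k Y_in_G.
have same j k := @identically_distributed_expectation _ _ _ _ Y _ _ _ (X j)
  (fun y => y ^+ k) (distX j) (@exprn_measurable R setT k) (iY k).
have iX j k : P.-integrable setT (EFin \o (fun w => X j w ^+ k)).
  by have [] := same j k.
have EX j k : ('E_P[fun w => (X j w ^+ k)%R] = 'E_Q[fun w => (Y w ^+ k)%R])%E.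
  by have [] := same j k.
have iS := partial_sum_integrable indepX iX.
pose m k := fine ('E_Q[fun w => (Y w ^+ k)%R])%E.
pose s i l := fine ('E_P[fun w => (partial_sum X i w ^+ l)%R])%E.
have mE k : ('E_Q[fun w => (Y w ^+ k)%R] = (m k)%:E)%E.
  by rewrite fineK// unlock; exact: (integrable_fin_num measurableT (iY k)).
have sE i l : ('E_P[fun w => (partial_sum X i w ^+ l)%R] = (s i l)%:E)%E.
  by rewrite fineK// unlock; exact: (integrable_fin_num measurableT (iS i l)).
have m0 : m 0%N = 1.
  by rewrite /m (_ : (fun w => _) = cst 1) ?expectation_cst.
have s0 : s 0%N n = 0.
  rewrite /s (_ : (fun w => _) = cst 0) ?expectation_cst//; apply/funext => w.
  by rewrite /partial_sum big_ord0 expr0n gtn_eqF.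
have srec i l : s i.+1 l =
    \sum_(0 <= k < l.+1) 'C(l, k)%:R * m k * s i (l - k)%N.
  apply: EFin_inj; rewrite -sE.
  have [_ ->] := partial_sum_moments indepX (iX i) (iS i) l.
  by rewrite -sumEFin; apply: eq_bigr => k _; rewrite EX mE sE -!EFinM.
have x1_gt0 : 0 < 1 + x by rewrite ltr_wpDr.
have x1_neq0 : 1 + x != 0 by rewrite gt_eqF.
have q1 : `|x / (1 + x)| < 1.
  rewrite ger0_norm; first by rewrite ltr_pdivrMr// mul1r ltrDr.
  exact: divr_ge0 (ltW x1_gt0).
have [w [wcvg wrec]] := binomial_recursion_cvg q1 m0 srec.
have W l : fubini X l x = ((1 + x)^-1 * w l)%:E.
  exact: fubini_EFin x_ge0 (sE ^~ l) (wcvg l).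
rewrite W wrec s0 add0r.
under [in RHS]eq_bigr do rewrite mE W -!EFinM.
rewrite sumEFin -EFinM; congr EFin.
under [in RHS]eq_bigr do rewrite mulrCA.
(* With q = x / (1 + x) one has 1 - q = (1 + x)^-1, which cancels the geometric
   prefactor of W n and leaves q = x (1 + x)^-1. *)
rewrite -mulr_sumr; field.
by rewrite x1_neq0 /= addrK oner_neq0.
Qed.
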